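(* Let $N\ge 1$, let $p_c:=\frac{2N}{N+1}<p\le 2$ and $0<q<p-1$. Let $u_0\in W^{1,\infty}(\mathbb{R}^N)$ satisfy $$\lim_{|x|\to\infty}|x|^{q/(1-q)}u_0(x)=\infty,\qquad u_0(x)>0\ \text{ for any } x\in\mathbb{R}^N.$$ Let $u$ be the solution to $\partial_t u-\Delta_p u+|\nabla u|^q=0$ in $(0,\infty)\times\mathbb{R}^N$ with $u(0)=u_0$, and let $\mathcal{P}(t):=\{x\in\mathbb{R}^N:\ u(t,x)>0\}$. Then $$\mathcal{P}(t)=\mathbb{R}^N\qquad\text{for any } t>0.$$
   Context: $\Delta_p u=\mathrm{div}(|\nabla u|^{p-2}\nabla u)$. For $p\in(p_c,2]$, $q>0$ and $u_0\in W^{1,\infty}(\mathbb{R}^N)$ with $u_0\ge0$, $u_0\not\equiv0$, it is known that the Cauchy problem $\partial_t u-\Delta_p u+|\nabla u|^q=0$ in $(0,\infty)\times\mathbb{R}^N$, $u(0)=u_0$, has a unique nonnegative viscosity solution $u\in\mathcal{BC}([0,\infty)\times\mathbb{R}^N)\cap L^\infty(0,\infty;W^{1,\infty}(\mathbb{R}^N))$ ($\mathcal{BC}$: bounded continuous functions), which is also a weak solution if $p<2$ and a classical solution if $p=2$, and satisfies $0\le u\le\|u_0\|_\infty$. ''The solution'' means this one. *)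

(* Defs.v *)
From HB Require Import structures.
From mathcomp Require Import all_boot all_order all_algebra.
From mathcomp Require Import all_classical all_reals all_analysis.

Set Implicit Arguments.
Unset Strict Implicit.
Unset Printing Implicit Defensive.

Import Order.TTheory GRing.Theory Num.Theory.
Import numFieldNormedType.Exports.

Local Open Scope classical_set_scope.
Local Open Scope ring_scope.

Section LebesgueRN.
Context {R : realType}.

Notation RB := (measurableTypeR R).

Definition cons_coord n (z : RB * n.-tuple RB) : n.+1.-tuple RB :=
  [tuple of z.1 :: z.2].

Definition uncons_coord n (t : n.+1.-tuple RB) : RB * n.-tuple RB :=
  (thead t, [tuple of behead t]).

Lemma cons_coordK n : cancel (@cons_coord n) (@uncons_coord n).
Proof. by move=> [a t]; congr pair => //; apply/val_inj. Qed.

Lemma uncons_coordK n : cancel (@uncons_coord n) (@cons_coord n).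
Proof. by move=> t; rewrite [RHS]tuple_eta. Qed.

Lemma measurable_cons_coord n : measurable_fun setT (@cons_coord n).
Proof. exact: measurable_cons. Qed.

Lemma measurable_uncons_coord n : measurable_fun setT (@uncons_coord n).
Proof.
apply/measurable_fun_pairP; split; first exact: (measurable_tnth ord0).
exact: measurable_behead.
Qed.


Section product_cons.
Variables (n : nat) (m : {sigma_finite_measure set (n.-tuple RB) -> \bar R}).

Definition product_cons : set (n.+1.-tuple RB) -> \bar R :=
  pushforward (@lebesgue_measure R \x m)%E (@cons_coord n).

Let product_cons0 : product_cons set0 = 0%E.
Proof. by rewrite /product_cons /pushforward preimage_set0 measure0. Qed.

Let product_cons_ge0 A : (0 <= product_cons A)%E.
Proof. by rewrite /product_cons /pushforward; apply: measure_ge0. Qed.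

Let product_cons_sigma_additive : semi_sigma_additive product_cons.
Proof.
move=> F mF tF mUF; rewrite /product_cons /pushforward preimage_bigcup.
apply: measure_semi_sigma_additive.
- by move=> k; rewrite -[X in measurable X]setTI; exact: measurable_cons_coord.
- apply/trivIsetP => /= i j _ _ ij; rewrite -preimage_setI.
  by move/trivIsetP : tF => /(_ _ _ _ _ ij) ->//; rewrite preimage_set0.
- rewrite -preimage_bigcup -[X in measurable X]setTI.
  exact: measurable_cons_coord.
Qed.

HB.instance Definition _ := isMeasure.Build _ _ _ product_cons
  product_cons0 product_cons_ge0 product_cons_sigma_additive.

Let product_cons_sigma_finite : sigma_finite setT product_cons.
Proof.
have /sigma_finiteP[F [TF ndF Foo]] := sigma_finiteT (@lebesgue_measure R).
have /sigma_finiteP[G [TG ndG Goo]] := sigma_finiteT m.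
exists (fun k => @uncons_coord n @^-1` (F k `*` G k)).
  rewrite -preimage_bigcup (_ : \bigcup_k _ = setT) ?preimage_setT//.
  rewrite -setXTT TF TG predeqE => -[x y]; split.
    by move=> [k _ []/= ? ?]; split; exists k.
  move=> [/= [k _ Fkx] [l _ Gly]]; exists (maxn k l) => //; split.
  - by move: x Fkx; exact/subsetPset/ndF/leq_maxl.
  - by move: y Gly; exact/subsetPset/ndG/leq_maxr.
move=> k; have [mF Fk] := Foo k; have [mG Gk] := Goo k; split.
  rewrite -[X in measurable X]setTI; apply: measurable_uncons_coord => //.
  exact: measurableX.
rewrite /product_cons /pushforward -comp_preimage.
rewrite (_ : _ \o _ = id); last by apply/funext => z /=; rewrite cons_coordK.
rewrite preimage_id product_measure1E//.
by rewrite lte_mul_pinfty// ge0_fin_numE.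
Qed.

HB.instance Definition _ := Measure_isSigmaFinite.Build _ _ _ product_cons
  product_cons_sigma_finite.

End product_cons.

(* Lebesgue measure on (the Borel sets of) R^n, by iterated products; coordinates
   are carried by n-tuples, whose product sigma-algebra the library provides. *)
Fixpoint lebesgue_tuple n : {sigma_finite_measure set (n.-tuple RB) -> \bar R} :=
  match n with
  | 0 => @dirac _ _ [tuple] R
  | n'.+1 => product_cons (lebesgue_tuple n')
  end.

End LebesgueRN.

Section Spaces.
Context {R : realType} {N : nat}.
Implicit Types (f g : 'rV[R]_N -> R) (x : 'rV[R]_N).

(* The canonical norm on 'rV is the sup norm; |x| here is the Euclidean one. *)
Definition enorm x : R := Num.sqrt (\sum_(i < N) x 0 i ^+ 2).

Definition evec (i : 'I_N) : 'rV[R]_N := delta_mx 0 i.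

Definition on_tuple f : N.-tuple (measurableTypeR R) -> R :=
  fun t => f (\row_i tnth t i).

(* ||f||_oo <= C; every Lebesgue class has a Borel representative, so Borel
   measurability loses nothing. *)
Definition Linfty_le f (C : R) : Prop :=
  measurable_fun setT (on_tuple f) /\
  ('N[lebesgue_tuple N]_+oo [EFin \o on_tuple f] <= C%:E)%E.

Definition Ccinfty f : Prop :=
  (forall (s : seq 'rV[R]_N) x, differentiable (foldr (fun v h => 'D_v h) f s) x)
  /\ exists r : R, forall x, r < enorm x -> f x = 0.

(* g is the i-th distributional derivative of f. *)
Definition weak_partial (i : 'I_N) f g : Prop :=
  forall phi, Ccinfty phi ->
  (\int[lebesgue_tuple N]_t (on_tuple (fun x => f x * 'D_(evec i) phi x) t)%:E
   = - \int[lebesgue_tuple N]_t (on_tuple (fun x => g x * phi x) t)%:E)%E.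

Definition W1infty_le f (C : R) : Prop :=
  Linfty_le f C /\
  forall i, exists2 g, Linfty_le g C & weak_partial i f g.

Definition W1infty f : Prop := exists C, W1infty_le f C.

End Spaces.

Section ViscositySolutions.
Context {R : realType} {N : nat}.

Notation spacetime := (R * 'rV[R]_N)%type.
Implicit Types (u psi : spacetime -> R) (z : spacetime) (p q : R).

Definition dt psi z : R := 'D_((1, 0) : spacetime) psi z.

Definition dx (i : 'I_N) psi z : R := 'D_((0, evec i) : spacetime) psi z.

Definition grad psi z : 'rV[R]_N := \row_i dx i psi z.

Definition plaplacian p psi z : R :=
  \sum_(i < N) dx i (fun y => enorm (grad psi y) `^ (p - 2) * dx i psi y) z.

Definition Qset : set spacetime := [set z | 0 < z.1].

Definition C2_on (A : set spacetime) psi : Prop :=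
  forall z, A z ->
  [/\ differentiable psi z,
      forall v, differentiable ('D_v psi) z
    & forall v w, {for z, continuous ('D_w ('D_v psi))}].

(* Radial profiles f in C^2([0, oo)) with f(0) = f'(0) = f''(0) = 0, f'' > 0 on
   (0, oo) and |f'(r)|^(p-2) f''(r) -> 0 as r -> 0. Any such f extends to a
   C^2 function on R by 0, so regularity is asked on R; only r >= 0 is used. *)
Definition radial_class p (f : R -> R) : Prop :=
  [/\ (forall r, derivable f r 1 /\ derivable (derive1 f) r 1)
        /\ continuous (derive1n 2 f : R -> R),
      [/\ f 0 = 0, derive1 f 0 = 0 & derive1n 2 f 0 = 0],
      (forall r, 0 < r -> 0 < derive1n 2 f r)
    & (fun r => `|derive1 f r| `^ (p - 2) * derive1n 2 f r) @ (0 : R)^'+ --> (0 : R)].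

Definition time_modulus (omega : R -> R) : Prop :=
  [/\ {within `[0, +oo[, continuous omega},
      (forall r, 0 <= r -> 0 <= omega r)
    & (fun r => omega r / r) @ (0 : R)^'+ --> (0 : R)].

(* For p < 2 the operator is singular where the gradient vanishes. As in
   Ishii-Souganidis and Ohnuma-Sato, test functions must be flat enough at
   their critical points. *)
Definition admissible p psi : Prop :=
  forall z0, Qset z0 -> grad psi z0 = 0 ->
  exists delta f omega,
    [/\ 0 < delta, radial_class p f, time_modulus omega
      & forall z, Qset z -> enorm (z.2 - z0.2) + `|z.1 - z0.1| < delta ->
        `|psi z - psi z0 - dt psi z0 * (z.1 - z0.1)|
          <= f (enorm (z.2 - z0.2)) + omega `|z.1 - z0.1| ].

Definition test_function p psi : Prop :=
  C2_on Qset psi /\ (p < 2 -> admissible p psi).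

(* At a critical point of an admissible test function (p < 2) the diffusion
   term is read as 0. For p = 2 the formula is the Laplacian everywhere, since
   a `^ 0 = 1 for all a. *)
Definition diffusion p psi z : R :=
  if (p < 2) && (grad psi z == 0) then 0 else plaplacian p psi z.

Definition operator p q psi z : R :=
  dt psi z - diffusion p psi z + enorm (grad psi z) `^ q.

Definition viscosity_subsolution p q u : Prop :=
  forall psi z, test_function p psi -> Qset z ->
  (\forall y \near z, u y - psi y <= u z - psi z) ->
  operator p q psi z <= 0.

Definition viscosity_supersolution p q u : Prop :=
  forall psi z, test_function p psi -> Qset z ->
  (\forall y \near z, u z - psi z <= u y - psi y) ->
  0 <= operator p q psi z.

(* Only the values of u at times t >= 0 matter. *)
Definition BC u : Prop :=
  {within [set z | 0 <= z.1], continuous u} /\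
  exists M : R, forall z, 0 <= z.1 -> `|u z| <= M.

Definition Linfty_W1infty u : Prop :=
  exists C : R, {ae @lebesgue_measure R,
    forall t, 0 < t -> W1infty_le (fun x => u (t, x)) C}.

(* These requirements characterize u uniquely when 2N/(N+1) < p <= 2, q > 0
   and u0 is nonnegative, nonzero and in W^{1,oo}. *)
Definition solution p q (u0 : 'rV[R]_N -> R) u : Prop :=
  [/\ forall z, 0 <= z.1 -> 0 <= u z,
      BC u,
      Linfty_W1infty u,
      viscosity_subsolution p q u /\ viscosity_supersolution p q u
    & forall x, u (0, x) = u0 x].

Definition positivity_set u (t : R) : set 'rV[R]_N := [set x | 0 < u (t, x)].

End ViscositySolutions.

(* Main.v *)
Require Import Defs.
From mathcomp Require Import all_boot all_order all_algebra.
From mathcomp Require Import all_classical all_reals all_analysis.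
From mathcomp Require Import ring lra.
Import Order.TTheory GRing.Theory Num.Theory.
Import numFieldNormedType.Exports.
Local Open Scope classical_set_scope.
Local Open Scope ring_scope.

(** Why the solution stays positive. Fix a point (t, x) with t > 0. Put
    b = q / (1 - q), s = |x|^2, and consider the barrier
      psi (tau, y) = A ((S - tau)^2 + 1) (K + s(y)^k)^(-g),  2 k g = b,
    whose profile decays at infinity exactly like |y|^(-b).

    This decay rate makes the absorption term proportional to the profile:
    |grad psi|^q <= (b M)^q Y^(-g) with Y = K + s^k and M a bound of the
    amplitude. Since q < 1, a large A makes (b M)^q <= A, which is half of the
    loss 2 A Y^(-g) caused by the time derivative when tau <= S - 1
    ([enorm_grad_barrier_le]). The condition 2 q < p, which follows from
    q < p - 1 <= p / 2, makes the diffusion term decay strictly faster than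
    the profile, so that a large K renders it negligible ([flux_weight_le]).
    Hence psi is a strict classical subsolution on 0 < tau < S - 1
    ([operator_barrier_lt0]).

    The data u0 dominate psi at time 0: far away because |y|^b u0(y) tends to
    infinity, and on a large box because u0 has a positive minimum there while
    psi is at most M K^(-g).

    No comparison theorem between sub- and supersolutions is involved: psi is
    itself an admissible test function ([test_function_barrier]). If u vanished
    at (t, x), then u - psi would be negative there; taking S - t large, psi is
    smaller at time S - 1 than its value at (t, x), and psi tends to 0 at
    infinity, so u - psi would have an interior minimum in a space-time
    cylinder, where the supersolution inequality contradicts the strict
    subsolution inequality ([supersolution_above_barrier]).

    The exponent 2 k of |y| in the profile is an even integer, so that psi is
    of class C^2 everywhere, and it is large, so that psi is flat enough at its
    critical points for the singular operator. The amplitude is quadratic in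
    tau, positive everywhere, and its Taylor remainder is exact: critical
    points of psi are then precisely the points with y = 0. *)

(** * Directional derivatives of elementary functions *)

Section ChainRule.
Context {R : realType} {V : normedModType R}.

Lemma is_derive_chain (f : V -> R) (g : R -> R) (z v : V) (df dg : R) :
  differentiable f z -> is_derive z v f df -> is_derive (f z) 1 g dg ->
  is_derive z v (g \o f) (dg * df).
Proof.
move=> dfz [_ <-] [gd <-].
have gdiff : differentiable g (f z) by apply/derivable1_diffP.
have dgf := differentiable_comp dfz gdiff.
apply: DeriveDef; first exact: diff_derivable.
by rewrite deriveE// diff_comp//= deriv1E// derive1E (deriveE v dfz) mulrC.
Qed.

Lemma is_derive_powR (f : V -> R) (a : R) (z v : V) (df : R) :
  0 < f z -> differentiable f z -> is_derive z v f df ->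
  is_derive z v (fun y => f y `^ a) (a * f z `^ (a - 1) * df).
Proof.
move=> f0 dfz fdf.
exact: (is_derive_chain f ((@powR R) ^~ a) z v df _ dfz fdf (is_derive1_powR a f0)).
Qed.

Lemma differentiable_powR (f : V -> R) (a : R) (z : V) :
  0 < f z -> differentiable f z -> differentiable (fun y => f y `^ a) z.
Proof.
move=> f0 dfz; apply: (@differentiable_comp _ _ _ _ f ((@powR R) ^~ a)) => //.
by apply/derivable1_diffP; apply: derivable_powR; rewrite in_itv/= f0.
Qed.

(** The difference quotient of a function that is affine along v is constant;
    this gives the derivatives of the time and space coordinates. *)
Lemma is_derive_homog (f : V -> R) (z v : V) :
  (forall h, f (h *: v + z) = h * f v + f z) -> is_derive z v f (f v).
Proof.
move=> fh.
have H : (fun h : R => h^-1 *: (f (h *: v + z) - f z)) @ 0^' --> f v.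
  apply: (cvg_trans (G := (fun=> f v) @ (0 : R)^')); last exact: cvg_cst.
  apply: near_eq_cvg; near=> h; rewrite fh addrK.
  rewrite [RHS](mulKf (x := h))//.
  by near: h; exact: nbhs_dnbhs_neq.
split; last exact: cvg_lim H.
exact: cvgP H.
Unshelve. all: by end_near. Qed.

End ChainRule.

Section Elementary.
Context {R : realType} {N : nat}.
Notation spacetime := (R * 'rV[R]_N)%type.

(** A class of functions closed under directional derivatives, each member of
    which is differentiable; membership therefore yields all the derivatives that
    a C^2 test function needs. Real powers are restricted to positive bases to
    stay away from their singularity. *)
Inductive elementary : (spacetime -> R) -> Prop :=
| elementary_cst c : elementary (fun=> c)
| elementary_time : elementary (fun z => z.1)
| elementary_coord i : elementary (fun z => z.2 0 i)
| elementaryD f g : elementary f -> elementary g ->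
    elementary (fun z => f z + g z)
| elementaryM f g : elementary f -> elementary g ->
    elementary (fun z => f z * g z)
| elementary_powR f a : (forall z, 0 < f z) -> elementary f ->
    elementary (fun z => f z `^ a).

Lemma is_derive_time (z v : spacetime) : is_derive z v (fun y => y.1) v.1.
Proof. exact: (@is_derive_homog _ _ (fun y : spacetime => y.1)). Qed.

Lemma is_derive_coord i (z v : spacetime) :
  is_derive z v (fun y => y.2 0 i) (v.2 0 i).
Proof.
apply: (@is_derive_homog _ _ (fun y : spacetime => y.2 0 i)) => h.
by rewrite /= !mxE.
Qed.

Lemma elementary_differentiable f z : elementary f -> differentiable f z.
Proof.
elim=> {f} [c||i|f g _ df _ dg|f g _ df _ dg|f a f0 _ df].
- exact: differentiable_cst.
- by apply: linear_differentiable; move=> x; exact: cvg_fst.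
- apply: (@differentiable_comp _ _ _ _ snd (fun M : 'rV[R]_N => M 0 i)).
    by apply: linear_differentiable; move=> x; exact: cvg_snd.
  exact: differentiable_coord.
- exact: differentiableD.
- exact: differentiableM.
- exact: differentiable_powR.
Qed.

Lemma elementary_derive f v : elementary f -> elementary ('D_v f).
Proof.
have ext g h : (forall z, is_derive z v g (h z)) -> elementary h ->
    elementary ('D_v g).
  by move=> gh; congr elementary; apply/funext => z; have [_ ->] := gh z.
have der g : elementary g -> forall z, is_derive z v g ('D_v g z).
  by move=> eg z; apply/derivableP/diff_derivable/elementary_differentiable.
elim=> {f} [c||i|f g ef df eg dg|f g ef df eg dg|f a f0 ef df].
- by apply: (ext _ (fun=> 0)); constructor.
- apply: (ext _ (fun=> v.1)) => [z|]; [exact: is_derive_time|constructor].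
- apply: (ext _ (fun=> v.2 0 i)) => [z|]; [exact: is_derive_coord|constructor].
- apply: (ext _ (fun z => 'D_v f z + 'D_v g z)) => [z|]; last by constructor.
  by apply: is_deriveD; exact: der.
- apply: (ext _ (fun z => f z * 'D_v g z + g z * 'D_v f z)) => [z|].
    by apply: is_deriveM; exact: der.
  by apply: elementaryD; apply: elementaryM.
- apply: (ext _ (fun z => a * f z `^ (a - 1) * 'D_v f z)) => [z|].
    by apply: is_derive_powR; [|exact: elementary_differentiable|exact: der].
  apply: elementaryM => //; apply: elementaryM; first by constructor.
  exact: elementary_powR.
Qed.

Lemma elementary_C2 (A : set spacetime) f : elementary f -> C2_on A f.
Proof.
move=> ef z _; split=> [|v|v w]; first exact: elementary_differentiable.
  by apply: elementary_differentiable; exact: elementary_derive.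
apply: differentiable_continuous; apply: elementary_differentiable.
by do 2!apply: elementary_derive.
Qed.

Lemma elementaryX f n : elementary f -> elementary (fun z => f z ^+ n).
Proof.
move=> ef; elim: n => [|n IHn]; first exact: (elementary_cst 1).
rewrite (_ : (fun _ => _) = (fun z => f z * f z ^+ n)); first exact: elementaryM.
by apply/funext => z; rewrite exprS.
Qed.

Lemma elementary_sum n (f : 'I_n -> spacetime -> R) :
  (forall i, elementary (f i)) -> elementary (fun z => \sum_i f i z).
Proof.
elim: n f => [|n IHn] f ef.
  rewrite (_ : (fun _ => _) = (fun=> 0)); first by constructor.
  by apply/funext => z; rewrite big_ord0.
rewrite (_ : (fun _ => _) = (fun z => f ord0 z + \sum_i f (lift ord0 i) z)).
  by apply: elementaryD => //; exact: IHn.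
by apply/funext => z; rewrite big_ord_recl.
Qed.

End Elementary.

(** * The barrier and its p-Laplacian *)

Section SquaredNorm.
Context {R : realType} {N : nat}.
Notation spacetime := (R * 'rV[R]_N)%type.
Implicit Types z : spacetime.

Definition sqnorm z : R := \sum_(i < N) z.2 0 i ^+ 2.

Lemma sqnorm_ge0 z : 0 <= sqnorm z.
Proof. by apply: sumr_ge0 => i _; exact: sqr_ge0. Qed.

Lemma sqnorm_eq0 z i : sqnorm z = 0 -> z.2 0 i = 0.
Proof.
move/eqP; rewrite psumr_eq0; last by move=> j _; exact: sqr_ge0.
by move=> /allP/(_ i); rewrite mem_index_enum sqrf_eq0 => /(_ isT)/eqP.
Qed.

Lemma enorm_sqnorm z : enorm z.2 = Num.sqrt (sqnorm z).
Proof. by []. Qed.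

Lemma elementary_sqnorm : elementary sqnorm.
Proof.
by apply: elementary_sum => i; apply: elementaryX; exact: elementary_coord.
Qed.

Lemma is_derive_sqnorm z i :
  is_derive z ((0, evec i) : spacetime) sqnorm (2 * z.2 0 i).
Proof.
have -> : sqnorm = \sum_(j < N) (fun y : spacetime => y.2 0 j) ^+ 2.
  by apply/funext => y; rewrite fct_sumE; apply: eq_bigr => j _.
have dc j := is_derive_coord j z ((0, evec i) : spacetime).
apply: is_derive_eq.
rewrite (bigD1 i)//= big1 ?addr0; last first.
  by move=> j ji; rewrite !mxE (negPf ji) andbF scaler0.
by rewrite !mxE !eqxx /= expr1 [LHS]mulr1.
Qed.

(** A factor depending on time alone is constant along spatial directions, so it
    comes out of the derivative whether or not it is differentiable. *)
Lemma is_derive_time_mul (h : R -> R) (f : spacetime -> R) z i df :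
  is_derive z ((0, evec i) : spacetime) f df ->
  is_derive z ((0, evec i) : spacetime) (fun y => h y.1 * f y) (h z.1 * df).
Proof.
move=> fdf.
have dh : is_derive z ((0, evec i) : spacetime) (fun y => h y.1) 0.
  have H : (fun r : R => r^-1 *: (h (r *: ((0, evec i) : spacetime) + z).1 - h z.1))
      @ 0^' --> (0 : R).
    apply: cvg_near_cst; near=> r.
    by rewrite /= scaler0 add0r subrr scaler0.
  by split; [exact: cvgP H|exact: cvg_lim H].
have -> : (fun y : spacetime => h y.1 * f y) = (fun y => h y.1) * f by [].
by apply: is_derive_eq; rewrite scaler0 addr0.
Unshelve. all: by end_near. Qed.

End SquaredNorm.

Section Barrier.
Context {R : realType} {N : nat}.
Variables (A S K g : R) (k : nat).
Hypotheses (A0 : 0 < A) (K0 : 0 < K) (k1 : (1 < k)%N).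
Notation spacetime := (R * 'rV[R]_N)%type.
Implicit Types (z : spacetime) (p : R).

Definition amplitude (t : R) : R := A * ((S - t) ^+ 2 + 1).

Definition profile_base z : R := K + sqnorm z ^+ k.

Definition barrier z : R := amplitude z.1 * profile_base z `^ (- g).

(** The spatial gradient of the barrier is -slope z times the position vector. *)
Definition slope z : R :=
  2 * g * k%:R * amplitude z.1 * profile_base z `^ (- g - 1)
  * sqnorm z ^+ k.-1.

Lemma amplitude_gt0 t : 0 < amplitude t.
Proof. by rewrite mulr_gt0// ltr_wpDl// sqr_ge0. Qed.

Lemma profile_base_gt0 z : 0 < profile_base z.
Proof. by rewrite ltr_wpDr// exprn_ge0// sqnorm_ge0. Qed.

Lemma elementary_profile_base : elementary profile_base.
Proof.
apply: (elementaryD (fun=> K)); first by constructor.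
by apply: elementaryX; exact: elementary_sqnorm.
Qed.

Lemma elementary_amplitude : elementary (fun z => amplitude z.1).
Proof.
apply: (elementaryM (fun=> A)); first by constructor.
apply: elementaryD; last by constructor.
apply: elementaryX.
rewrite (_ : (fun _ => _) = (fun z : spacetime => S + (-1) * z.1)).
  apply: elementaryD; first by constructor.
  by apply: elementaryM; constructor.
by apply/funext => z; rewrite mulN1r.
Qed.

Lemma elementary_barrier : elementary barrier.
Proof.
apply: elementaryM; first exact: elementary_amplitude.
by apply: elementary_powR; [exact: profile_base_gt0|exact: elementary_profile_base].
Qed.

Lemma is_derive_profile_base z i :
  is_derive z ((0, evec i) : spacetime) profile_base
    (2 * k%:R * sqnorm z ^+ k.-1 * z.2 0 i).
Proof.
have ds := is_derive_sqnorm z i.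
have -> : profile_base = cst K + sqnorm ^+ k.
  by apply/funext => y; rewrite fctE exprfctE.
by apply: is_derive_eq; rewrite add0r [LHS]mulrA; ring.
Qed.

Lemma is_derive_base_powR a z i :
  is_derive z ((0, evec i) : spacetime) (fun y => profile_base y `^ a)
    (a * profile_base z `^ (a - 1) * (2 * k%:R * sqnorm z ^+ k.-1 * z.2 0 i)).
Proof.
apply: is_derive_powR; first exact: profile_base_gt0.
  by apply: elementary_differentiable; exact: elementary_profile_base.
exact: is_derive_profile_base.
Qed.

Lemma dx_barrier z i : dx i barrier z = - slope z * z.2 0 i.
Proof.
have [_ db] := is_derive_time_mul amplitude _ z i _ (is_derive_base_powR (- g) z i).
by apply: (etrans db); rewrite /slope; ring.
Qed.

Lemma dt_barrier z :
  dt barrier z = - (2 * A * (S - z.1)) * profile_base z `^ (- g).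
Proof.
have dtime := is_derive_time z ((1, 0) : spacetime).
have dbase : is_derive z ((1, 0) : spacetime) (fun y => profile_base y `^ (- g)) 0.
  apply: DeriveDef.
    apply/diff_derivable/differentiable_powR; first exact: profile_base_gt0.
    by apply: elementary_differentiable; exact: elementary_profile_base.
  rewrite /derive; apply: cvg_lim => //; apply: cvg_near_cst.
  near=> h; rewrite /= /profile_base /sqnorm/= scaler0 add0r subrr scaler0//.
rewrite /dt.
have -> : barrier = (A *: ((cst S - (fun y : spacetime => y.1)) ^+ 2 + cst 1))
  * (fun y => profile_base y `^ (- g)).
  by apply/funext => y; rewrite !fctE.
rewrite derive_val !fctE /GRing.scale/=; ring.
Unshelve. all: by end_near. Qed.

Lemma slope_ge0 z : 0 <= g -> 0 <= slope z.
Proof.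
move=> g0; rewrite /slope; apply: mulr_ge0; last by rewrite exprn_ge0 ?sqnorm_ge0.
apply: mulr_ge0; last exact: powR_ge0.
apply: mulr_ge0; last exact/ltW/amplitude_gt0.
by rewrite !mulr_ge0.
Qed.

Lemma slope_gt0 z : 0 < g -> 0 < sqnorm z -> 0 < slope z.
Proof.
move=> g0 s0; rewrite /slope; apply: mulr_gt0; last exact: exprn_gt0.
apply: mulr_gt0; last by rewrite powR_gt0// profile_base_gt0.
apply: mulr_gt0; last exact: amplitude_gt0.
by rewrite !mulr_gt0// ltr0n ltnW.
Qed.

Lemma enorm_grad_barrier z : 0 <= g ->
  enorm (grad barrier z) = slope z * Num.sqrt (sqnorm z).
Proof.
move=> g0; rewrite /enorm.
under eq_bigr do rewrite mxE dx_barrier exprMn sqrrN.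
by rewrite -mulr_sumr sqrtrM ?sqr_ge0// sqrtr_sqr ger0_norm ?slope_ge0.
Qed.


Section PLaplacian.
Variable p : R.
Hypotheses (p1 : 1 < p) (g0 : 0 < g).

(** The power of |x|^2 carried by the p-Laplacian flux |grad psi|^(p-2) grad psi.
    Twice this number is (2 k - 1) (p - 1) - 1; its positivity expresses the
    flatness of the barrier at the origin. *)
Definition flux_power : R := (k.-1)%:R * (p - 1) + (p - 2) / 2.

Hypothesis nu0 : 0 < flux_power.

(** The flux |grad psi|^(p-2) grad psi is -flux_weight z times the position
    vector. *)
Definition flux_weight z : R :=
  (2 * g * k%:R * amplitude z.1) `^ (p - 1)
  * (profile_base z `^ (- ((g + 1) * (p - 1))) * sqnorm z `^ flux_power).

(** Positivity of the flux power is what makes this valid at the origin as well: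
    powers of s = 0 add up as long as the total exponent is not 0. *)
Lemma flux_barrier z i :
  enorm (grad barrier z) `^ (p - 2) * dx i barrier z = - flux_weight z * z.2 0 i.
Proof.
rewrite enorm_grad_barrier ?ltW// dx_barrier.
rewrite !mulNr mulrN mulrA; congr (- (_ * _)).
have s0 := sqnorm_ge0 z; have b0 := profile_base_gt0 z.
have sl0 : 0 <= slope z by apply/slope_ge0/ltW.
have c0 : 0 <= 2 * g * k%:R * amplitude z.1.
  by rewrite mulr_ge0 ?(ltW (amplitude_gt0 _))// !mulr_ge0// ltW.
rewrite powRM ?sqrtr_ge0// mulrAC mulrC [slope z `^ _ * _]mulrC.
rewrite (_ : p - 2 = p - 1 - 1); last by ring.
rewrite mulr_powRB1 ?subr_gt0// /slope.
rewrite powRM ?exprn_ge0//; last by rewrite mulr_ge0// powR_ge0.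
rewrite powRM ?powR_ge0// /flux_weight.
rewrite -[Num.sqrt _]powR12_sqrt// -(powR_mulrn k.-1 s0) -!powRrM.
rewrite /flux_power [sqnorm z `^ (_ + _)]powRD; last first.
  by apply/implyP => /eqP e; move: nu0; rewrite /flux_power e ltxx.
rewrite (_ : (- g - 1) * _ = - ((g + 1) * (p - 1))); last by ring.
rewrite (_ : 2^-1 * _ = (p - 2) / 2); last by field.
ring.
Qed.

Lemma is_derive_flux z i : 0 < sqnorm z ->
  is_derive z ((0, evec i) : spacetime) (fun y => - flux_weight y * y.2 0 i)
    (- flux_weight z - (2 * g * k%:R * amplitude z.1) `^ (p - 1)
     * (2 * flux_power * profile_base z `^ (- ((g + 1) * (p - 1)))
          * sqnorm z `^ (flux_power - 1)
        - 2 * k%:R * (g + 1) * (p - 1) * profile_base z `^ (- ((g + 1) * (p - 1)) - 1)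
          * sqnorm z `^ flux_power * sqnorm z ^+ k.-1) * z.2 0 i ^+ 2).
Proof.
move=> s0.
have ds := is_derive_powR _ flux_power z _ _ s0
  (elementary_differentiable _ z elementary_sqnorm) (is_derive_sqnorm z i).
have db := is_derive_base_powR (- ((g + 1) * (p - 1))) z i.
have dW := is_derive_time_mul (fun t => (2 * g * k%:R * amplitude t) `^ (p - 1))
   _ z i _ (is_deriveM db ds).
have dF := is_deriveM (is_deriveN dW) (is_derive_coord i z ((0, evec i) : spacetime)).
apply: (is_derive_eq dF).
rewrite /GRing.scale/= !mxE !eqxx /=  /flux_weight !fctE.
ring.
Qed.

(** The divergence of -W(s) x splits into -(N + 2 nu) W, coming from the dimension
    and from the factor s^nu, and a contribution of the decreasing factor
    Y^(-(g+1)(p-1)), which is nonnegative and is dropped. *)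
Lemma plaplacian_barrier_ge z : 0 < sqnorm z ->
  - plaplacian p barrier z <= (N%:R + 2 * flux_power) * flux_weight z.
Proof.
move=> s0; rewrite /plaplacian.
under eq_bigr => i _.
  rewrite (_ : (fun _ => _) = (fun y => - flux_weight y * y.2 0 i)); last first.
    by apply/funext => y; exact: flux_barrier.
  rewrite /dx (derive_val (is_derive := is_derive_flux z i s0)) .
  over.
rewrite big_split/= sumr_const card_ord sumrN -mulr_sumr -/(sqnorm z).
have sE : sqnorm z * sqnorm z `^ (flux_power - 1) = sqnorm z `^ flux_power.
  by rewrite mulr_powRB1// ltW.
have b0 := profile_base_gt0 z.
set C := (2 * _ * _ * _) `^ _; set B := profile_base z `^ _.
set B' := profile_base z `^ _; set s := sqnorm z in s0 sE *.
have -> : flux_weight z = C * (B * s `^ flux_power) by [].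
rewrite -subr_ge0 [leRHS](_ : _ =
    C * (2 * k%:R * (g + 1) * (p - 1) * B' * s `^ flux_power * s ^+ k.-1 * s)).
  by rewrite !mulr_ge0 ?powR_ge0 ?exprn_ge0 ?subr_ge0 ?addr_ge0 ?(ltW s0) ?(ltW p1) ?(ltW g0).
rewrite -sE; ring.
Qed.

End PLaplacian.

Lemma elementary_slopeN : elementary (fun z => - slope z).
Proof.
rewrite (_ : (fun _ => _) = (fun z => (-1) * (((2 * g * k%:R) * amplitude z.1
  * profile_base z `^ (- g - 1)) * sqnorm z ^+ k.-1))); last first.
  by apply/funext => z; rewrite mulN1r.
apply: elementaryM; first by constructor.
apply: elementaryM; last by apply: elementaryX; exact: elementary_sqnorm.
apply: elementaryM.
  by apply: elementaryM; [constructor|exact: elementary_amplitude].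
by apply: elementary_powR; [exact: profile_base_gt0|exact: elementary_profile_base].
Qed.

(** For p = 2 the diffusion at the origin is a genuine Laplacian: it is the
    divergence of -slope x, where the slope vanishes at the origin because k > 1. *)
Lemma plaplacian_barrier_center z : sqnorm z = 0 -> 0 < g -> plaplacian 2 barrier z = 0.
Proof.
move=> s0 g0; rewrite /plaplacian big1// => i _.
have -> : (fun y => enorm (grad barrier y) `^ (2 - 2) * dx i barrier y)
    = (fun y => - slope y) * (fun y => y.2 0 i).
  by apply/funext => y; rewrite subrr powRr0 mul1r dx_barrier.
have dslope : differentiable (fun y => - slope y) z.
  apply: elementary_differentiable; exact: elementary_slopeN.
have dm : derivable (fun y => - slope y) z ((0, evec i) : spacetime).
  exact: diff_derivable.
have [_ ds] := is_deriveM (derivableP dm) (is_derive_coord i z ((0, evec i) : spacetime)).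
apply: (etrans ds).
have xi0 := sqnorm_eq0 z i s0.
have sl0 : slope z = 0.
  rewrite /slope s0 expr0n (_ : (k.-1 == 0)%N = false) ?mulr0//.
  by move: k1; case: (k) => [|[|?]].
by rewrite xi0 sl0 oppr0 !scale0r addr0.
Qed.

End Barrier.

(** * The barrier is a strict subsolution *)

Section StrictSubsolution.
Context {R : realType} {N : nat}.
Variables (A S K g p q : R) (k : nat).
Hypotheses (A0 : 0 < A) (K0 : 0 < K) (k1 : (1 < k)%N).
Hypotheses (p1 : 1 < p) (q0 : 0 < q) (g0 : 0 < g).
Hypothesis decay : 2 * k%:R * g * (1 - q) = q.
Hypothesis nu0 : 0 < flux_power k p.
Notation spacetime := (R * 'rV[R]_N)%type.
Notation barrier := (@barrier R N A S K g k).
Notation base := (@profile_base R N K k).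
Notation amp := (amplitude A S).
Implicit Types z : spacetime.

Let kR : k%:R != 0 :> R.
Proof. by rewrite pnatr_eq0 -lt0n ltnW. Qed.

Let kR0 : 0 < k%:R :> R.
Proof. by rewrite ltr0n ltnW. Qed.

Let kpred : k.-1%:R = k%:R - 1 :> R.
Proof. by rewrite -{2}(prednK (ltnW k1)) -natr1 addrK. Qed.

Let slopeC_ge0 : 0 <= 2 * g * k%:R.
Proof. by rewrite !mulr_ge0// ltW. Qed.

(** Every factor s^e can be traded for Y^(e/k), since s^k <= Y = K + s^k. All the
    bounds below reduce to comparing powers of Y. *)
Lemma sqnorm_powR_le z (e : R) : 0 <= e ->
  sqnorm z `^ e <= base z `^ (e / k%:R).
Proof.
move=> e0; rewrite (_ : sqnorm z `^ e = (sqnorm z ^+ k) `^ (e / k%:R)).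
  apply: ge0_ler_powR; rewrite ?nnegrE ?exprn_ge0 ?sqnorm_ge0 ?divr_ge0//.
    by rewrite ltW// profile_base_gt0.
  by rewrite /base lerDr ltW.
by rewrite -powR_mulrn ?sqnorm_ge0// -powRrM mulrC divfK.
Qed.

(** The slope times |x| is at most a constant times Y^(-g - 1/(2k)), and raising
    this to the power q gives back exactly Y^(-g) when 2 k g (1 - q) = q: the decay
    rate of the barrier is the one balancing absorption and time derivative. *)
Lemma enorm_grad_barrier_le z (M : R) : amp z.1 <= M ->
  enorm (grad barrier z) `^ q <= (2 * g * k%:R * M) `^ q * base z `^ (- g).
Proof.
move=> aM; rewrite enorm_grad_barrier ?(ltW g0)//.
have b0 := profile_base_gt0 K k K0 z.
have a0 := amplitude_gt0 A S A0 z.1.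
have M0 := mulr_ge0 slopeC_ge0 (le_trans (ltW a0) aM).
rewrite (_ : - g = (- g - (2 * k%:R)^-1) * q); last first.
  apply: (mulfI (x := 2 * k%:R)); first by rewrite mulf_neq0.
  rewrite [RHS](_ : _ = - (2 * k%:R * g * q + q)); last by field.
  by move: decay; lra.
rewrite powRrM -powRM ?powR_ge0//.
apply: ge0_ler_powR; [exact: ltW| | |].
- by rewrite nnegrE mulr_ge0 ?sqrtr_ge0// slope_ge0// ltW.
- by rewrite nnegrE mulr_ge0 ?powR_ge0.
rewrite /slope -[Num.sqrt _]powR12_sqrt ?sqnorm_ge0// -powR_mulrn ?sqnorm_ge0//.
rewrite -mulrA -powRD; last by rewrite gt_eqF// ltr_wpDl.
rewrite -[leLHS]mulrA; apply: ler_pM.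
- exact: mulr_ge0 slopeC_ge0 (ltW a0).
- by rewrite mulr_ge0 ?powR_ge0.
- exact: ler_wpM2l.
apply: (@le_trans _ _ (base z `^ (- g - 1) * base z `^ ((k.-1%:R + 2^-1) / k%:R))).
  by rewrite ler_wpM2l ?powR_ge0// sqnorm_powR_le// addr_ge0.
rewrite -powRD; last by rewrite (gt_eqF b0) implybT.
rewrite (_ : - g - 1 + _ = - g - (2 * k%:R)^-1)//.
by rewrite kpred; field.
Qed.

(** The extra decay, in powers of Y, of the diffusion term over the profile. It
    equals (p - 2 q) / (2 k (1 - q)). *)
Definition diffusion_gain : R := p / (2 * k%:R) - g * (2 - p).

Lemma diffusion_gain_gt0 : q < p - 1 -> p <= 2 -> 0 < diffusion_gain.
Proof.
move=> qp p2; have q1 : 0 < 1 - q by move: qp p2; lra.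
rewrite -(pmulr_rgt0 (x := 2 * k%:R * (1 - q))); last by rewrite !mulr_gt0.
rewrite [ltRHS](_ : _ = p * (1 - q) - (2 * k%:R * g * (1 - q)) * (2 - p)); last first.
  by rewrite /diffusion_gain; field.
by rewrite decay; lra.
Qed.

(** The surplus power Y^(-diffusion_gain) is bounded by K^(-diffusion_gain),
    which is as small as desired for K large. *)
Lemma flux_weight_le z (M : R) : amp z.1 <= M -> 0 <= diffusion_gain ->
  flux_weight A S K g k p z <=
  (2 * g * k%:R * M) `^ (p - 1) * K `^ (- diffusion_gain) * base z `^ (- g).
Proof.
move=> aM e0; have b0 := profile_base_gt0 K k K0 z.
have a0 := amplitude_gt0 A S A0 z.1.
have M0 : 0 <= M by exact: le_trans (ltW a0) aM.
rewrite /flux_weight -[leRHS]mulrA; apply: ler_pM; rewrite ?mulr_ge0 ?powR_ge0//.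
  apply: ge0_ler_powR; first by rewrite subr_ge0 ltW.
  - by rewrite nnegrE mulr_ge0// ltW.
  - by rewrite nnegrE mulr_ge0.
  - exact: ler_wpM2l.
apply: (@le_trans _ _ (base z `^ (- ((g + 1) * (p - 1))) * base z `^ (flux_power k p / k%:R))).
  by rewrite ler_wpM2l ?powR_ge0// sqnorm_powR_le// ltW.
rewrite -powRD; last by rewrite (gt_eqF b0) implybT.
rewrite (_ : _ + _ = - diffusion_gain + - g); last first.
  rewrite /diffusion_gain /flux_power.
  by rewrite kpred; field.
rewrite powRD; last by rewrite (gt_eqF b0) implybT.
rewrite ler_wpM2r ?powR_ge0// !powRN lef_pV2 ?posrE ?powR_gt0//.
apply: ge0_ler_powR; rewrite ?nnegrE ?(ltW b0) ?(ltW K0)//.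
by rewrite /base lerDl exprn_ge0// sqnorm_ge0.
Qed.

(** At the origin the diffusion term is 0, by convention if p < 2 and by direct
    computation if p = 2; elsewhere it is the p-Laplacian. *)
Lemma diffusion_barrier_ge z :
  p <= 2 ->
  - diffusion p barrier z <= (N%:R + 2 * flux_power k p) * flux_weight A S K g k p z.
Proof.
move=> p2; have w0 : 0 <= (N%:R + 2 * flux_power k p) * flux_weight A S K g k p z.
  by rewrite !mulr_ge0 ?powR_ge0// addr_ge0// mulr_ge0// ltW.
rewrite /diffusion; case: ifPn => [_|crit]; first by rewrite oppr0.
have := sqnorm_ge0 z; rewrite le_eqVlt => /predU1P[s0|s0]; last first.
  exact: plaplacian_barrier_ge.
have p2E : p = 2.
  apply/eqP; move: crit; apply: contraNT => p2'; rewrite lt_neqAle p2' p2/=.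
  apply/eqP/rowP => i; rewrite mxE dx_barrier//.
  by rewrite (sqnorm_eq0 z i) ?mulr0 ?mxE.
by rewrite {1}p2E plaplacian_barrier_center// oppr0.
Qed.

(** The time derivative contributes at most -2 A Y^(-g), the absorption at most
    A Y^(-g) and the diffusion at most (A / 2) Y^(-g). *)
Lemma operator_barrier_lt0 z (M : R) : p <= 2 -> q < p - 1 ->
  z.1 <= S - 1 -> amp z.1 <= M ->
  (2 * g * k%:R * M) `^ q <= A ->
  (N%:R + 2 * flux_power k p) * ((2 * g * k%:R * M) `^ (p - 1) * K `^ (- diffusion_gain))
    <= A / 2 ->
  operator p q barrier z < 0.
Proof.
move=> p2 qp zS aM gradM diffM.
have y0 : 0 < base z `^ (- g) by rewrite powR_gt0// profile_base_gt0.
have n0 : 0 <= N%:R + 2 * flux_power k p by rewrite addr_ge0// mulr_ge0// ltW.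
have h1 := enorm_grad_barrier_le z M aM.
have h2 := diffusion_barrier_ge z p2.
have h3 := ler_wpM2l n0 (flux_weight_le z M aM (ltW (diffusion_gain_gt0 qp p2))).
have h4 := ler_wpM2r (ltW y0) gradM.
have h5 := ler_wpM2r (ltW y0) diffM.
have h6 : dt barrier z <= - (2 * A) * base z `^ (- g).
  rewrite dt_barrier// ler_wpM2r ?(ltW y0)// lerN2 ler_peMr//; last by lra.
  by rewrite mulr_ge0// ltW.
rewrite /operator.
have h7 : 0 < A * base z `^ (- g) by rewrite mulr_gt0.
move: h1 h2 h3 h4 h5 h6 h7; nra.
Qed.

End StrictSubsolution.

(** * The barrier is an admissible test function *)

Section Moduli.
Context {R : realType}.

Lemma is_derive_monomial (c : R) (n : nat) (r : R) :
  is_derive r 1 (fun x : R => c * x ^+ n) (c * n%:R * r ^+ n.-1).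
Proof.
have -> : (fun x : R => c * x ^+ n) = c *: (id : R -> R) ^+ n.
  by apply/funext => x; rewrite !fctE.
by apply: is_derive_eq; rewrite /GRing.scale/= mulr1 mulrA.
Qed.

Lemma derive1_monomial (c : R) (n : nat) :
  derive1 (fun x : R => c * x ^+ n) = (fun x => c * n%:R * x ^+ n.-1).
Proof.
by apply/funext => r; rewrite derive1E (derive_val (is_derive := is_derive_monomial c n r)).
Qed.

(** Here |f'|^(p-2) f'' is a multiple of r^(2 flux_power k p), so it tends to 0
    exactly because the flux power is positive. *)
Lemma radial_class_monomial (p C : R) k : 0 < C -> (1 < k)%N -> 1 < p ->
  0 < flux_power k p -> radial_class p (fun r => C * r ^+ (2 * k)%N).
Proof.
move=> C0 k1 p1 nu0.
have k21 : (2 < 2 * k)%N by rewrite (leq_trans _ (leq_mul (leqnn 2) k1)).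
have c2 : 0 < C * (2 * k)%N%:R by rewrite mulr_gt0// ltr0n (ltn_trans _ k21).
have c1 : 0 < ((2 * k).-1)%:R :> R by rewrite ltr0n -ltnS prednK ?(ltn_trans _ k21)// (ltn_trans _ k21).
have d2 : derive1n 2 (fun r => C * r ^+ (2 * k)%N) =
    (fun r => C * (2 * k)%N%:R * ((2 * k).-1)%:R * r ^+ (2 * k).-2).
  by rewrite derive1nS derive1n1 !derive1_monomial.
split.
- split.
    move=> r; rewrite derive1_monomial; split.
      by have [] := is_derive_monomial C (2 * k) r.
    by have [] := is_derive_monomial (C * (2 * k)%N%:R) (2 * k).-1 r.
  rewrite d2 => r; apply: cvgM; first exact: cvg_cst.
  exact: exprn_continuous.
- rewrite d2 derive1_monomial; case: (k) k1 k21 => [|[|n]]// _ _.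
  by rewrite !mulnS /= !expr0n/= !mulr0.
- by move=> r r0; rewrite d2; apply: mulr_gt0 (mulr_gt0 c2 c1) (exprn_gt0 _ r0).
- rewrite d2 derive1_monomial.
  set c := C * _ in c2 *; set m := ((2 * k).-1)%:R in c1 *.
  apply: (cvg_trans (G := (fun r => c `^ (p - 2) * c * m * r `^ (2 * flux_power k p)) @ 0^'+)).
    apply: near_eq_cvg; near=> r.
    have r0 : 0 < r by near: r; exact: nbhs_right_gt.
    rewrite (gtr0_norm (mulr_gt0 c2 (exprn_gt0 _ r0))) [(c * r ^+ _) `^ _]powRM ?exprn_ge0 ?(ltW c2) ?(ltW r0)//.
rewrite -!powR_mulrn ?(ltW r0)// -powRrM.
    have -> : 2 * flux_power k p = (2 * k).-1%:R * (p - 2) + (2 * k).-2%:R.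
      rewrite /flux_power; case: (k) k1 => [|[|n]]// _.
      rewrite !mulnS /= add0n (natrD _ 1 (2 + 2 * n)) (natrD _ 2 (2 * n)) (natrM _ 2 n) -natr1; by field.
    rewrite [r `^ (_ + _)]powRD; last by rewrite (gt_eqF r0) implybT.
    ring.
  have H : c `^ (p - 2) * c * m * r `^ (2 * flux_power k p) @[r --> 0^'+]
      --> c `^ (p - 2) * c * m * 0.
    by apply: cvgM; [exact: cvg_cst|apply: powR_cvg0; rewrite mulr_gt0].
  by rewrite mulr0 in H.
Unshelve. all: by end_near. Qed.

Lemma time_modulus_sqr (A : R) : 0 <= A -> time_modulus (fun r => A * r ^+ 2).
Proof.
move=> A0; split.
- apply: continuous_subspaceT => r; apply: cvgM; first exact: cvg_cst.
  exact: exprn_continuous.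
- by move=> r r0; rewrite mulr_ge0// exprn_ge0.
- apply: (cvg_trans (G := (fun r => A * r) @ 0^'+)).
    apply: near_eq_cvg; near=> r.
    have r0 : 0 < r by near: r; exact: nbhs_right_gt.
    by rewrite expr2 mulrA mulfK// gt_eqF.
  have H : A * r @[r --> (0 : R)^'+] --> A * 0.
    by apply: cvg_at_right_filter; apply: cvgM; [exact: cvg_cst|exact: cvg_id].
  by rewrite mulr0 in H.
Unshelve. all: by end_near. Qed.

(** For g <= 1 and a ratio rho = K / (K + x) <= 1 one has rho <= rho^g, hence
    1 - rho^g <= 1 - rho <= x. *)
Lemma powRN_sub_le (K g x : R) : 1 <= K -> 0 <= g <= 1 -> 0 <= x ->
  0 <= K `^ (- g) - (K + x) `^ (- g) <= x.
Proof.
move=> K1 /andP[g0 g1] x0.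
have K0 : 0 < K by exact: lt_le_trans K1.
have Y0 : 0 < K + x by rewrite ltr_wpDr.
have Kg1 : K `^ (- g) <= 1.
  by rewrite powRN invf_le1 ?powR_gt0// -[leLHS](powRr0 K) ler_powR.
have r0 : 0 < K / (K + x) by rewrite divr_gt0.
have r1 : K / (K + x) <= 1 by rewrite ler_pdivrMr// mul1r lerDl.
have -> : K `^ (- g) - (K + x) `^ (- g) = K `^ (- g) * (1 - (K / (K + x)) `^ g).
  rewrite mulrBr mulr1 powRM ?invr_ge0 ?(ltW K0) ?(ltW Y0)//.
  rewrite -powR_inv1 ?(ltW Y0)// -powRrM mulN1r mulrA -powRD ?addNr ?powRr0 ?mul1r//.
  by rewrite (gt_eqF K0) implybT.
have rg1 : (K / (K + x)) `^ g <= 1.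
  by rewrite -[leRHS](powRr0 (K / (K + x))) ger_powR// r0.
rewrite mulr_ge0 ?powR_ge0 ?subr_ge0//=.
apply: (@le_trans _ _ (1 - (K / (K + x)) `^ g)).
  by rewrite ler_piMl// subr_ge0.
apply: (@le_trans _ _ (1 - K / (K + x))).
  by rewrite lerB// ger1_powR// r0.
rewrite lerBlDr -lerBlDl ler_pdivlMr//.
nra.
Qed.

End Moduli.

Section TestFunction.
Context {R : realType} {N : nat}.
Variables (A S K g : R) (k : nat).
Hypotheses (A0 : 0 < A) (K1 : 1 <= K) (k1 : (1 < k)%N) (g01 : 0 < g <= 1).
Notation spacetime := (R * 'rV[R]_N)%type.
Notation barrier := (@barrier R N A S K g k).

Lemma grad_barrier_eq0 z : grad barrier z = 0 -> z.2 = 0.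
Proof.
have [g0 g1] := andP g01.
have K0 : 0 < K by exact: lt_le_trans K1.
move=> /rowP gz; suff s0 : sqnorm z = 0.
  by apply/rowP => i; rewrite mxE sqnorm_eq0.
apply/eqP; rewrite eq_le sqnorm_ge0 andbT leNgt; apply/negP => s0.
have xi0 i : z.2 0 i = 0.
  move: (gz i) => /eqP; rewrite !mxE dx_barrier// mulNr oppr_eq0 mulf_eq0.
  by move=> /orP[|/eqP//]; rewrite gt_eqF// slope_gt0.
by move: s0; rewrite /sqnorm big1 ?ltxx// => i _; rewrite xi0 expr0n.
Qed.

(** The critical points have y = 0. There the increment of the barrier minus its
    linear part in time splits exactly into -amplitude * (K^(-g) - Y^(-g)), bounded
    by a multiple of |y|^(2k), and K^(-g) A (tau - tau0)^2. *)
Lemma test_function_barrier p : 1 < p -> 0 < flux_power k p ->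
  test_function p barrier.
Proof.
move=> p1 nu0; have [g0 g1] := andP g01.
have K0 : 0 < K by exact: lt_le_trans K1.
split; first by apply: elementary_C2; exact: elementary_barrier.
move=> _ z0 z00 /grad_barrier_eq0 x0.
pose C := A * ((`|S - z0.1| + 1) ^+ 2 + 1).
exists 1, (fun r => C * r ^+ (2 * k)%N), (fun r => A * r ^+ 2); split => //.
- apply: radial_class_monomial => //.
  by rewrite mulr_gt0// ltr_wpDl// exprn_ge0// addr_ge0.
- exact/time_modulus_sqr/ltW.
move=> z _ zz0.
have t1 : `|z.1 - z0.1| < 1.
  by apply: le_lt_trans zz0; rewrite lerDr sqrtr_ge0.
have s00 : sqnorm z0 = 0.
  by rewrite /sqnorm x0 big1// => i _; rewrite mxE expr0n.
have -> : enorm (z.2 - z0.2) ^+ (2 * k) = sqnorm z ^+ k.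
  by rewrite x0 subr0 enorm_sqnorm exprM sqr_sqrtr ?sqnorm_ge0.
have b0 : profile_base K k z0 = K by rewrite /profile_base s00 expr0n gtn_eqF ?addr0// ltnW.
rewrite dt_barrier// b0 /barrier b0.
have -> : amplitude A S z.1 * profile_base K k z `^ (- g)
    - amplitude A S z0.1 * K `^ (- g) - - (2 * A * (S - z0.1)) * K `^ (- g) * (z.1 - z0.1)
  = - (amplitude A S z.1 * (K `^ (- g) - profile_base K k z `^ (- g)))
    + K `^ (- g) * (A * `|z.1 - z0.1| ^+ 2).
  by rewrite real_normK ?num_real// /amplitude; ring.
have g01' : 0 <= g <= 1 by rewrite (ltW g0).
have /andP[d0 d1] := powRN_sub_le K g (sqnorm z ^+ k) K1 g01' (exprn_ge0 k (sqnorm_ge0 z)).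
have Kg1 : K `^ (- g) <= 1.
  by rewrite powRN invf_le1 ?powR_gt0// -[leLHS](powRr0 K) ler_powR// ltW.
have amp_le : amplitude A S z.1 <= C.
  rewrite ler_wpM2l ?(ltW A0)// lerD2r -real_normK ?num_real//.
  rewrite ler_pXn2r ?nnegrE ?addr_ge0//.
  rewrite (_ : S - z.1 = (S - z0.1) - (z.1 - z0.1)); last by ring.
  by rewrite (le_trans (ler_normB _ _))// lerD2l ltW.
apply: le_trans (ler_normD _ _) _; rewrite normrN; apply: lerD.
- have a0 := ltW (amplitude_gt0 A S A0 z.1).
  by rewrite (ger0_norm (mulr_ge0 a0 d0)); exact: ler_pM.
- rewrite ger0_norm; last by rewrite mulr_ge0 ?powR_ge0// mulr_ge0// ltW.
  by rewrite ler_piMl// mulr_ge0// ltW.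
Qed.

End TestFunction.

(** * Interior minima in a space-time cylinder *)

Section Comparison.
Context {R : realType} {N : nat}.
Notation spacetime := (R * 'rV[R]_N)%type.

(** The cross-section is a box instead of a ball: its compactness is that of a
    product of segments, and outside it |x| is still at least rho. *)
Definition cylinder (T rho : R) : set spacetime :=
  `[0, T] `*` [set v : 'rV[R]_N | forall i, v 0 i \in `[- rho, rho]].

Lemma compact_cylinder T rho : compact (cylinder T rho).
Proof.
apply: compact_setX; first exact: segment_compact.
apply: (@rV_compact R N (fun=> [set` `[- rho, rho]])) => i.
exact: segment_compact.
Qed.

Lemma cylinder_interior T rho (z : spacetime) :
  0 < z.1 < T -> (forall i, `|z.2 0 i| < rho) -> \near z, cylinder T rho z.
Proof.
move=> z1 z2.
have ct : {for z, continuous (fun y : spacetime => y.1)} by exact: cvg_fst.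
have cx i : {for z, continuous (fun y : spacetime => y.2 0 i)}.
  apply: differentiable_continuous; apply: elementary_differentiable.
  exact: elementary_coord.
have nt : nbhs z ((fun y : spacetime => y.1) @^-1` [set` `]0, T[]).
  by apply: ct; apply: near_in_itvoo; rewrite in_itv.
have nx : nbhs z (fun y : spacetime => forall i, y.2 0 i \in `]- rho, rho[).
  apply: (@filter_forall _ _ (fun i (y : spacetime) => y.2 0 i \in `]- rho, rho[) _ (nbhs_filter z)).
  move=> i; apply: (cx i [set` `]- rho, rho[]); apply: near_in_itvoo.
  by rewrite in_itv/= -ltr_norml.
near=> y; split => /=.
  by apply: subset_itv_oo_cc; near: y.
by move=> i; apply: subset_itv_oo_cc; move: i; near: y.
Unshelve. all: by end_near. Qed.

(** If the conclusion fails, the minimum of u - psi over the cylinder is at most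
    -m < 0. It cannot be attained at the initial time, at the final time T or on
    the lateral boundary, because u >= 0 and psi < m on the last two. So it is an
    interior minimum, at which psi touches u from below up to a constant. *)
Lemma supersolution_above_barrier (p q T rho m : R) (u psi : spacetime -> R) :
  (forall z, 0 <= z.1 -> 0 <= u z) ->
  {within [set z | 0 <= z.1], continuous u} ->
  viscosity_supersolution p q u ->
  test_function p psi ->
  continuous psi ->
  (forall z, 0 < z.1 < T -> operator p q psi z < 0) ->
  0 < m ->
  (forall x, psi (0, x) <= u (0, x)) ->
  (forall x, psi (T, x) < m) ->
  (forall (z : spacetime) i, 0 <= z.1 <= T -> rho <= `|z.2 0 i| -> psi z < m) ->
  forall z, 0 <= z.1 <= T -> psi z < u z + m.
Proof.
move=> u0 cu sup test cpsi neg m0 init final lateral z1 z1T.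
rewrite ltNge; apply/negP => low.
have inside (z : spacetime) : 0 <= z.1 <= T -> u z + m <= psi z -> forall i, `|z.2 0 i| < rho.
  move=> zT zm i; rewrite ltNge; apply/negP => /(lateral _ _ zT).
  by rewrite ltNge (le_trans _ zm)// lerDr u0//; case/andP: zT.
have incyl (z : spacetime) : 0 <= z.1 <= T -> (forall i, `|z.2 0 i| < rho) -> cylinder T rho z.
  move=> zT zi; split => /=; first by rewrite in_itv.
  by move=> i; rewrite in_itv/= -ler_norml ltW.
have z1cyl := incyl _ z1T (inside _ z1T low).
have [c /set_mem ccyl cmin] : exists2 c, c \in cylinder T rho &
    forall z, z \in cylinder T rho -> u c - psi c <= u z - psi z.
  apply: (compact_EVT_min (f := fun z => u z - psi z)).
  - by exists z1.
  - exact: compact_cylinder.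
  - have cu' : {within cylinder T rho, continuous u}.
      apply: continuous_subspaceW cu => z [/=]; rewrite in_itv/= => /andP[+ _] _.
      by [].
    move=> z; apply: continuousB; first exact: cu'.
    exact: (continuous_subspaceT cpsi).
have cT : 0 <= c.1 <= T by have [/=] := ccyl; rewrite in_itv.
have cm : u c + m <= psi c.
  by have := cmin _ (mem_set z1cyl); move: low; lra.
have c0 : c.1 != 0.
  apply: contraTneq cm => e; rewrite -ltNge.
  have := init c.2; rewrite -e -surjective_pairing; move: m0; lra.
have cT' : c.1 != T.
  apply: contraTneq cm => e; rewrite -ltNge.
  have := final c.2; rewrite -e -surjective_pairing => fc.
  rewrite (lt_le_trans fc)// lerDr u0//; by case/andP: cT.
have c0T : 0 < c.1 < T by have /andP[? ?] := cT; rewrite !lt_neqAle eq_sym c0 cT'/=; exact/andP.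
have /andP[cpos _] := c0T.
have := neg c c0T; rewrite ltNge => /negP; apply.
apply: sup => //.
have := cylinder_interior _ _ _ c0T (inside _ cT cm).
by apply: filterS => y ycyl; exact/cmin/mem_set.
Qed.

End Comparison.

(** * Choice of the parameters and positivity *)

Section Exponents.
Context {R : realType}.

(** Most of the largeness requirements on K and on the radius of the cylinder
    are instances of this decay. *)
Lemma powRN_small (e c : R) : 0 < e -> 0 < c ->
  exists K0, forall K, K0 <= K -> K `^ (- e) <= c.
Proof.
move=> e0 c0; exists (c `^ (- e^-1)) => K cK.
have K10 : 0 < c `^ (- e^-1) by exact: powR_gt0.
have K0 : 0 < K by exact: lt_le_trans cK.
rewrite powRN -[leRHS]invrK lef_pV2 ?posrE ?invr_gt0 ?powR_gt0//.
have -> : c^-1 = (c `^ (- e^-1)) `^ e.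
  by rewrite -powRrM mulNr mulVf ?gt_eqF// powR_inv1// ltW.
apply: ge0_ler_powR => //; first exact: ltW.
  by rewrite nnegrE ltW.
by rewrite nnegrE ltW.
Qed.

(** The bound b <= 2 k makes the outer exponent g = b / (2 k) at most 1, as needed
    to bound increments of the profile. *)
Lemma exists_profile_exponent (p b : R) : 1 < p -> 0 < b ->
  exists k : nat, [/\ (1 < k)%N, b <= 2 * k%:R & 0 < flux_power k p].
Proof.
move=> p1 b0; have d0 : 0 < p - 1 by rewrite subr_gt0.
have di0 : 0 < (p - 1)^-1 by rewrite invr_gt0.
have x0 : 0 <= b + (p - 1)^-1 by rewrite addr_ge0// ltW.
have := archi_boundP x0; move: (Num.bound _) => n xn.
have n2 : n.+2%:R = n%:R + 2 :> R by rewrite -[n.+2]addn2 natrD.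
exists n.+2; split => //; first by rewrite n2; lra.
have n1 : n.+1%:R = n%:R + 1 :> R by rewrite natr1.
rewrite /flux_power /= n1.
have : 1 < n%:R * (p - 1).
  by rewrite -ltr_pdivrMr// div1r; move: b0 xn; lra.
nra.
Qed.

End Exponents.

Section Slice.
Context {R : realType} {N : nat}.

(** The initial slice of the box is a cylinder of height 0, so the minimum
    is provided by the continuity of u up to time 0. *)
Lemma positive_min_on_box (u : R * 'rV[R]_N -> R) (r : R) : 0 <= r ->
  {within [set z | 0 <= z.1], continuous u} -> (forall x, 0 < u (0, x)) ->
  exists2 m : R, 0 < m &
    forall x : 'rV[R]_N, (forall i, `|x 0 i| <= r) -> m <= u (0, x).
Proof.
move=> r0 cu u0.
have [c /set_mem [/= c1 c2] cmin] : exists2 c, c \in cylinder 0 r &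
    forall z, z \in cylinder 0 r -> u c <= u z.
  apply: compact_EVT_min.
  - exists (0, 0); split => /=; first by rewrite in_itv/= lexx.
    by move=> i; rewrite mxE in_itv/= oppr_le0 r0.
  - exact: compact_cylinder.
  - by apply: continuous_subspaceW cu => z [/=]; rewrite in_itv/= => /andP[].
exists (u c).
  have -> : c = (0, c.2); last exact: u0.
  by move: c1; rewrite in_itv/= -eq_le => /eqP {1}->; exact: surjective_pairing.
move=> x xr; apply/cmin/mem_set; split => /=; first by rewrite in_itv/= lexx.
by move=> i; rewrite in_itv/= -ler_norml.
Qed.

Lemma sqnorm_coord_le (z : R * 'rV[R]_N) i : `|z.2 0 i| ^+ 2 <= sqnorm z.
Proof.
rewrite real_normK ?num_real// /sqnorm (bigD1 i)//= lerDl.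
by apply: sumr_ge0 => j _; exact: sqr_ge0.
Qed.

End Slice.

Theorem theorem1p2 (R : realType) (N : nat) (p q : R)
    (u0 : 'rV[R]_N -> R) (u : R * 'rV[R]_N -> R)
    (hN : (1 <= N)%N)
    (hp : 2 * N%:R / (N%:R + 1) < p <= 2)
    (hq : 0 < q < p - 1)
    (hu0 : W1infty u0)
    (hu0_decay : forall A : R, exists r : R, forall x : 'rV[R]_N,
       r < enorm x -> A < enorm x `^ (q / (1 - q)) * u0 x)
    (hu0_pos : forall x : 'rV[R]_N, 0 < u0 x)
    (hu : solution p q u0 u) (t : R) (ht : 0 < t) :
  positivity_set u t = [set: 'rV[R]_N].
Proof.
have [q0 qp] := andP hq; have [_ p2] := andP hp.
have [u_ge0 [cu _] _ [_ sup] u_init] := hu.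
have p1 : 1 < p by move: q0 qp; lra.
have q1 : 0 < 1 - q by move: qp p2; lra.
rewrite -subTset => x _ /=; rewrite /positivity_set/=.
set b := q / (1 - q); have b0 : 0 < b by rewrite divr_gt0.
have [k [k1 bk nu0]] := exists_profile_exponent p b p1 b0.
have k0 : 0 < k%:R :> R by rewrite ltr0n ltnW.
pose g := b / (2 * k%:R); have g0 : 0 < g by rewrite divr_gt0// mulr_gt0.
have g1 : g <= 1 by rewrite ler_pdivrMr ?mul1r// mulr_gt0.
have kgb : 2 * g * k%:R = b by rewrite /g; field; rewrite gt_eqF.
have decay : 2 * k%:R * g * (1 - q) = q.
  by rewrite (mulrAC 2 k%:R g) kgb /b divfK// gt_eqF.
(* The gap L between t and the final time t + L is such that 2 < ((L + 1)^2 + 1) / 2^g: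
   the amplitude drops by more than the factor 2^g that the profile may vary by
   between the origin and x. *)
(* The barrier lives up to the time S - 1 = t + L, where the amplitude still decreases
   at the rate 2 A. *)
pose L : R := 2 * 2 `^ g; pose S := t + L + 1.
have L0 : 0 < L by rewrite mulr_gt0// powR_gt0.
(* The exponent b is chosen so that A^(1 - q) = (b (S^2 + 1))^q. *)
pose A := (b * (S ^+ 2 + 1)) `^ b; pose M := A * (S ^+ 2 + 1).
have S20 : 0 < S ^+ 2 + 1 by rewrite ltr_wpDl// sqr_ge0.
have A0 : 0 < A by rewrite powR_gt0// mulr_gt0.
have M0 : 0 < M by rewrite mulr_gt0.
have gradA : (2 * g * k%:R * M) `^ q <= A.
  rewrite kgb /M mulrCA powRM ?(ltW A0)//; last by rewrite mulr_ge0// ltW.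
  rewrite {1}/A -powRrM -powRD; last by rewrite (gt_eqF (mulr_gt0 b0 S20)) implybT.
  by rewrite (_ : b * q + q = b)// /b; field; rewrite gt_eqF.
(* Outside the box of half-width r' the decay hypothesis applies; inside, the positive
   minimum of the initial data does. *)
have [r far] := hu0_decay M.
pose r' := `|r| + 1.
have r'0 : 0 <= r' by rewrite addr_ge0.
have [m0 m00 near_min] : exists2 m : R, 0 < m &
    forall y : 'rV[R]_N, (forall i, `|y 0 i| <= r') -> m <= u (0, y).
  by apply: positive_min_on_box => // y; rewrite u_init.
have e0 := diffusion_gain_gt0 g p q k k1 decay qp p2.
set D := (N%:R + 2 * flux_power k p) * (2 * g * k%:R * M) `^ (p - 1).
have D0 : 0 < D.
  apply: mulr_gt0; first by rewrite ltr_wpDl// mulr_gt0.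
  by rewrite powR_gt0// kgb mulr_gt0.
have [K1 K1P] := powRN_small _ (A / 2 / D) e0 (divr_gt0 (divr_gt0 A0 (ltr0Sn _ _)) D0).
have [K2 K2P] := powRN_small g (m0 / M) g0 (divr_gt0 m00 M0).
(* K dominates, in this order: 1, for the increments of the profile; |x|^(2k), for the
   comparison of psi at time S - 1 with psi (t, x); K1, for the diffusion; K2, for the
   initial data on the box. *)
pose K := Num.max (Num.max 1 (sqnorm (t, x) ^+ k)) (Num.max K1 K2).
have [K_ge1 K_ges K_geK1 K_geK2] : [/\ 1 <= K, sqnorm (t, x) ^+ k <= K, K1 <= K & K2 <= K].
  by rewrite /K !le_max !lexx !orbT.
have K0 : 0 < K by exact: lt_le_trans K_ge1.
pose psi := @barrier R N A S K g k.
have base0 z : 0 < profile_base (N := N) K k z := profile_base_gt0 K k K0 z.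
have amp_le z1 : 0 <= z1 <= S - 1 -> amplitude A S z1 <= M.
  move=> /andP[z10 z1S]; rewrite ler_wpM2l ?(ltW A0)// lerD2r.
  have Sz : 0 <= S - z1 by move: z1S; lra.
  have SzS : S - z1 <= S by move: z10; lra.
  by apply: lerXn2r => //; rewrite nnegrE (le_trans Sz).
have powN_le (y y' : R) : 0 < y -> y <= y' -> y' `^ (- g) <= y `^ (- g).
  move=> y0 yy'; rewrite !powRN lef_pV2 ?posrE ?powR_gt0 ?(lt_le_trans y0)//.
  by apply: ge0_ler_powR; rewrite ?nnegrE ?(ltW g0) ?(ltW y0)// (le_trans (ltW y0)).
have psi_gt0 z : 0 < psi z by rewrite mulr_gt0 ?powR_gt0// amplitude_gt0.
pose m := psi (t, x).
have m_gt0 : 0 < m by exact: psi_gt0.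
have [rho1 rho1P] := powRN_small g (m / 2 / M) g0 (divr_gt0 (divr_gt0 m_gt0 (ltr0Sn _ _)) M0).
pose rho := Num.max 1 rho1.
have [rho_ge1 rho_ge] : 1 <= rho /\ rho1 <= rho by rewrite /rho !le_max !lexx orbT.
have cpsi : continuous psi.
  move=> z; apply: differentiable_continuous; apply: elementary_differentiable.
  exact: elementary_barrier.
have test : test_function p psi by apply: test_function_barrier => //; rewrite g0.
have neg z : 0 < z.1 < S - 1 -> operator p q psi z < 0.
  move=> /andP[z10 z1S]; apply: (operator_barrier_lt0 A S K g p q k A0 K0 k1 p1 q0 g0 decay nu0 z M p2 qp) => //.
  - exact: ltW.
  - by apply: amp_le; rewrite !ltW.
  - by rewrite mulrA -/D mulrC -ler_pdivlMr// K1P.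
have base_geK z : K <= profile_base (N := N) K k z.
  by rewrite lerDl exprn_ge0// sqnorm_ge0.
have init y : psi (0, y) <= u (0, y).
  have -> : psi (0, y) = M * profile_base K k (0, y) `^ (- g).
    by rewrite /psi /barrier /amplitude/= subr0.
  have [close|] := pselect (forall i, `|y 0 i| <= r').
    apply: le_trans (near_min _ close); rewrite mulrC -ler_pdivlMr//.
    apply: le_trans (K2P K K_geK2); exact: powN_le.
  move=> /existsNP[i /negP]; rewrite -ltNge => r'i.
  have sr : `|y 0 i| ^+ 2 <= sqnorm (0, y) := sqnorm_coord_le (0, y) i.
  have yr : r' < enorm y.
    rewrite (lt_le_trans r'i)// -(sqrtr_sqr (y 0 i)) -real_normK ?num_real//.
    exact: ler_wsqrtr.
  have y0 : 0 < enorm y by exact: le_lt_trans yr.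
  have s0 : 0 < sqnorm (0, y) by rewrite -sqrtr_gt0.
  rewrite u_init; apply: (@le_trans _ _ (M * enorm y `^ (- b))).
    rewrite ler_wpM2l ?(ltW M0)//.
    have -> : enorm y `^ (- b) = (sqnorm (0, y) ^+ k) `^ (- g).
      rewrite /enorm -/(sqnorm (0, y)) -powR12_sqrt ?(ltW s0)//.
      rewrite -powR_mulrn ?(ltW s0)// -!powRrM; congr (_ `^ _).
      by rewrite -kgb; field.
    apply: powN_le; first by rewrite exprn_gt0.
    by rewrite lerDr ltW.
  rewrite powRN ler_pdivrMr ?powR_gt0// mulrC ltW// far//.
  by rewrite (le_lt_trans _ yr)// (le_trans (ler_norm r))// lerDl.
have final y : psi (S - 1, y) < m.
  have -> : psi (S - 1, y) = A * 2 * profile_base K k (S - 1, y) `^ (- g).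
    by rewrite /psi /barrier /amplitude/= subKr expr1n.
  have -> : m = A * ((L + 1) ^+ 2 + 1) * profile_base K k (t, x) `^ (- g).
    rewrite /m /psi /barrier /amplitude/=; congr (_ * (_ ^+ 2 + 1) * _).
    by rewrite /S; ring.
  have h1 := powN_le _ _ K0 (base_geK (S - 1, y)).
  have h2 : (2 * K) `^ (- g) <= profile_base K k (t, x) `^ (- g).
    by apply: powN_le => //; rewrite /profile_base; move: K_ges; lra.
  have Kg0 : 0 < K `^ (- g) by rewrite powR_gt0.
  apply: (@le_lt_trans _ _ (A * 2 * K `^ (- g))).
    by rewrite ler_wpM2l// mulr_ge0// ltW.
  apply: (@lt_le_trans _ _ (A * ((L + 1) ^+ 2 + 1) * (2 * K) `^ (- g))); last first.
    by rewrite ler_wpM2l// mulr_ge0 ?(ltW A0)// addr_ge0// sqr_ge0.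
  rewrite powRM ?(ltW K0)// mulrA ltr_pM2r// -mulrA ltr_pM2l//.
  rewrite powRN ltr_pdivlMr ?powR_gt0// -/L.
  by move: L0; nra.
have lateral (z : R * 'rV[R]_N) i : 0 <= z.1 <= S - 1 -> rho <= `|z.2 0 i| -> psi z < m.
  move=> zS zi; have rho0 : 0 < rho by exact: lt_le_trans rho_ge1.
  have s_rho : rho <= sqnorm z.
    apply: le_trans (sqnorm_coord_le z i); apply: (le_trans zi).
    by rewrite ler_eXnr// (le_trans rho_ge1).
  have b_rho : rho <= profile_base K k z.
    apply: (le_trans s_rho); apply: (@le_trans _ _ (sqnorm z ^+ k)).
      by rewrite ler_eXnr ?(ltnW k1)// (le_trans rho_ge1).
    by rewrite lerDr ltW.
  apply: (@le_lt_trans _ _ (M * rho `^ (- g))).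
    apply: ler_pM; [exact/ltW/amplitude_gt0|exact: powR_ge0|exact: amp_le|].
    exact: powN_le.
  apply: (@le_lt_trans _ _ (m / 2)); last by move: m_gt0; lra.
  by rewrite mulrC -ler_pdivlMr// rho1P.
have /= := supersolution_above_barrier p q (S - 1) rho m u psi u_ge0 cu sup test
  cpsi neg m_gt0 init final lateral (t, x).
rewrite -/m => H.
suff : m < u (t, x) + m by rewrite ltrDr.
by apply: H => /=; move: ht L0; rewrite /S; lra.
Qed.
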